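(* Let $a\geq 1$, $b\geq 0$ and $k\geq 2$ be integers. Then either $\sigma(an+b)$ is not a perfect $k$th power for any natural number $n$, or $\sigma(an+b)$ is a perfect $k$th power for infinitely many natural numbers $n$.
   Context: $\sigma(m)$ denotes the sum of the positive divisors of $m$. Natural numbers are $\{1,2,3,\ldots\}$. *)

(* Defs.v *)
From mathcomp Require Import all_boot.
Set Implicit Arguments. Unset Strict Implicit. Unset Printing Implicit Defensive.

Definition sigma (m : nat) : nat := \sum_(d <- divisors m) d.

Definition is_kth_power (k m : nat) : Prop := exists x : nat, m = x ^ k.

(* Main.v *)
(* If sigma(m) is a k-th power with m = a n0 + b, look for squarefree t = 1 mod a,
   coprime to m, all of whose prime factors p are large and such that
   sigma(t) = prod (p + 1) is a k-th power; then m t = m mod a and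
   sigma(m t) = sigma(m) sigma(t).  Among N vectors over Z/e with R coordinates,
   N >= e^2 R, some nonempty subfamily sums to zero.  Applied to the vectors of
   valuations of p + 1 (together with the indicators of the residue classes of p
   mod a), this produces t from any finite set of primes p that is large compared
   with the number of primes dividing some p + 1.  Such a set consists of the primes
   p <= X for which p + 1 has no prime factor above X / M: a discarded prime is
   p = m q - 1 with q prime and m <= M, and Brun's pure sieve shows that these are
   o(X / log X), whereas the surviving p + 1 only involve
   pi(X / M) = O(X / (M log X)) primes, M being an arbitrary constant. *)

Require Import Defs.
From Stdlib Require Import Classical_Prop.
From mathcomp Require Import all_boot all_order all_algebra all_field all_solvable.
From mathcomp Require Import zify ring lra.
Set Implicit Arguments. Unset Strict Implicit. Unset Printing Implicit Defensive.
Import Order.TTheory GRing.Theory Num.Theory.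

(** * Brun's pure sieve *)

Lemma linear_congruence (e f g l : nat) : 0 < l -> coprime e l ->
  exists2 t0, t0 < l & forall t, (e * t + f == g %[mod l]) = (t %% l == t0).
Proof.
move=> l_gt0 co.
have [e0|e_gt0] := posnP e.
  exists 0 => // t; move: co; rewrite e0 /coprime gcd0n => /eqP ->.
  by rewrite !modn1.
have [u v uv _] := egcdnP l e_gt0.
move: uv; rewrite (eqP co) => uv.
have ue : u * e = 1 %[mod l] by rewrite uv modnMDl.
(* [u] inverts [e] modulo [l], and [l.-1 * f] stands for -f modulo [l]. *)
exists ((u * (g + l.-1 * f)) %% l); first by rewrite ltn_mod.
move=> t; apply/eqP/eqP => [h|h].
  have -> : t %% l = (u * e * t) %% l by rewrite -modnMml ue modnMml mul1n.
  rewrite -[RHS]modnMmr -modnDml -h modnDml modnMmr.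
  rewrite (_ : u * (_ + _) = u * f * l + u * e * t) ?modnMDl //.
  by case: l l_gt0 {co uv ue h} => //= l _; ring.
rewrite -modnDml -modnMmr h modnMmr mulnA (mulnC e u) -modnMml ue modnMml mul1n.
rewrite modnDml.
rewrite (_ : g + _ + f = f * l + g) ?modnMDl //.
by case: l l_gt0 {co uv ue h} => //= l _; ring.
Qed.

(** The two inequalities say that [T'] differs from T / l by less than 1, which is the precision
    that the sieve needs. *)
Lemma count_residue (l t0 T : nat) (P : pred nat) : t0 < l ->
  exists T', [/\ T <= t0 + l * T', t0 + l * T' < T + l &
    count (fun t => (t %% l == t0) && P t) (iota 0 T) =
    count (fun t => P (t0 + l * t)) (iota 0 T')].
Proof.
move=> t0l; elim: T => [|T [T' [h1 h2 e]]].
  by exists 0; rewrite muln0 addn0.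
have iotaS n : iota 0 n.+1 = rcons (iota 0 n) n.
  by rewrite -cats1 -[n.+1]addn1 iotaD.
have [eT|nT] := eqVneq T (t0 + l * T').
  exists T'.+1; split; [lia|lia|].
  have hm : T %% l = t0 by rewrite eT addnC mulnC modnMDl modn_small.
  by rewrite !iotaS -!cats1 !count_cat e /= hm eqxx -eT.
exists T'; split; [lia|lia|].
rewrite iotaS -cats1 count_cat e /=.
case: eqP => [hm|_] /=; last by rewrite !addn0.
have := divn_eq T l; rewrite hm => hT; exfalso.
have l_gt0 : 0 < l by apply: leq_ltn_trans t0l.
move: (T %/ l) hT => q hT.
have qT' : q <= T' by rewrite -(leq_pmul2r l_gt0); lia.
have T'q : T' < q.+1 by rewrite -(ltn_pmul2r l_gt0); lia.
by move/eqP: nT; apply; rewrite hT (_ : q = T') 1?addnC 1?mulnC //; lia.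
Qed.

Local Open Scope ring_scope.

(* The progression c + d t, rather than just an initial segment, makes the induction
   of Buchstab's identity [sifted_cons] go through. *)
Definition sifted (m c d : nat) (Q : seq nat) (T : nat) : nat :=
  count (fun t => all (fun l => ~~ (l %| c + d * t)%N &&
     (m * (c + d * t) != 1 %[mod l])%N) Q) (iota 0 T).

Definition sieve_density (Q : seq nat) : rat := \prod_(l <- Q) (1 - 2 / l%:R).
Definition sieve_tail (Q : seq nat) : rat := \prod_(l <- Q) (1 + 4 / l%:R).

Lemma sieve_tail_ge1 Q : 1 <= sieve_tail Q.
Proof.
rewrite /sieve_tail; elim: Q => [|l Q IH]; first by rewrite big_nil.
rewrite big_cons -[leLHS]mulr1 ler_pM // lerDl divr_ge0 //; exact: ler0n.
Qed.

Lemma sieve_density_bound Q : all prime Q -> 0 <= sieve_density Q <= 1.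
Proof.
rewrite /sieve_density; elim: Q => [|l Q IH]; first by rewrite big_nil ler01 lexx.
rewrite big_cons /= => /andP[pl /IH /andP[v0 v1]].
have l2 : (2 : rat) <= l%:R by rewrite ler_nat prime_gt1.
have a0 : 0 <= (2 / l%:R : rat) by rewrite divr_ge0 // ler0n.
have a1 : (2 / l%:R : rat) <= 1 by rewrite ler_pdivrMr ?mul1r //; lra.
apply/andP; split; first by rewrite mulr_ge0 //; lra.
by rewrite mulr_ile1 //; lra.
Qed.

(** A [t] that survives [Q] but not [l] lies in exactly one of two classes modulo [l], because 0 and
    1 are distinct there. Each class is again a progression, of difference [d * l], and [T1], [T2]
    are within 1 of T / l. *)
Lemma sifted_cons m c d l Q T : prime l -> coprime d l -> coprime m l ->
  exists c1 T1 c2 T2, [/\ sifted m c d Q T =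
     (sifted m c d (l :: Q) T + sifted m c1 (d * l) Q T1 + sifted m c2 (d * l) Q T2)%N,
     (T <= l * T1 + l)%N, (l * T1 <= T + l)%N,
     (T <= l * T2 + l)%N & (l * T2 <= T + l)%N].
Proof.
move=> pl cdl cml; have l_gt0 := prime_gt0 pl.
have [t1 t1l h1] := linear_congruence c 0 l_gt0 cdl.
have cmd : coprime (m * d) l by rewrite coprimeMl cml.
have [t2 t2l h2] := linear_congruence (m * c) 1 l_gt0 cmd.
pose P t := all (fun l => ~~ (l %| c + d * t)%N &&
     (m * (c + d * t) != 1 %[mod l])%N) Q.
have [T1 [b1 b1' e1]] := count_residue T P t1l.
have [T2 [b2 b2' e2]] := count_residue T P t2l.
exists (c + d * t1)%N, T1, (c + d * t2)%N, T2; split; try lia.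
have -> : sifted m (c + d * t1) (d * l) Q T1 =
   count (fun t => P (t1 + l * t)%N) (iota 0 T1).
  apply: eq_count => t; rewrite /P.
  by rewrite (_ : c + d * (t1 + l * t) = c + d * t1 + d * l * t)%N //; ring.
have -> : sifted m (c + d * t2) (d * l) Q T2 =
   count (fun t => P (t2 + l * t)%N) (iota 0 T2).
  apply: eq_count => t; rewrite /P.
  by rewrite (_ : c + d * (t2 + l * t) = c + d * t2 + d * l * t)%N //; ring.
rewrite -e1 -e2 /sifted -/P.
elim: (iota 0 T) => //= t s IH; rewrite IH.
set q := P t; rewrite -h1 -h2.
have -> : (d * t + c == 0 %[mod l])%N = (l %| c + d * t)%N.
  by rewrite addnC /dvdn mod0n.
have -> : (m * d * t + m * c == 1 %[mod l])%N = (m * (c + d * t) == 1 %[mod l])%N.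
  by rewrite mulnDr mulnA addnC.
rewrite -/(P t) -/q.
case: (boolP (l %| _)%N) => [dv|_] /=; last by case: eqP => _; case: q => /=; lia.
have -> : (m * (c + d * t) == 1 %[mod l])%N = false.
  apply/negbTE; rewrite (eqP (dvdn_mull m dv : (_ == 0)%N)) modn_small ?prime_gt1 //.
by case: q => /=; lia.
Qed.

(* [sieve_tail Q / 2 ^+ r] is Rankin's bound for the r-th elementary symmetric function
   of the 2 / l, which bounds the error of inclusion-exclusion truncated at level r. *)
Lemma brun_sieve (m : nat) (Q : seq nat) : uniq Q -> all prime Q ->
  all (coprime m) Q -> forall (r c d T : nat), all (coprime d) Q ->
  `|(sifted m c d Q T)%:R - T%:R * sieve_density Q| <=
     T%:R * (sieve_tail Q / 2 ^+ r) + (1 + sieve_tail Q) * ((2 * (size Q)%:R + 2) ^+ r - 1).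
Proof.
elim: Q => [|l Q IH].
  move=> _ _ _ r c d T _; rewrite /sifted /= count_predT size_iota /sieve_density /sieve_tail !big_nil.
  rewrite mulr1 subrr normr0 mulr0 add0r.
  have h : 1 <= (2 : rat) ^+ r by rewrite exprn_ege1 //.
  rewrite addr_ge0 ?mulr_ge0 ?ler0n ?invr_ge0 ?divr_ge0 //; lra.
move=> /= /andP[lQ uQ] /andP[pl pQ] /andP[cml cmQ] r c d T /andP[cdl cdQ].
have [c1 [T1 [c2 [T2 [E b1 b1' b2 b2']]]]] := sifted_cons c Q T pl cdl cml.
have l_gt0 := prime_gt0 pl.
have lR : 0 < (l%:R : rat) by rewrite ltr0n.
have HlQ := sieve_tail_ge1 (l :: Q).
have /andP[v0 v1] := @sieve_density_bound (l :: Q) (introT andP (conj pl pQ)).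
have /andP[vq0 vq1] := sieve_density_bound pQ.
have HQ := sieve_tail_ge1 Q.
(* At level 0 the allowed error is [T] times [sieve_tail], so the trivial bounds 0 <= S <= T
   suffice. *)
case: r => [|r].
  rewrite !expr0 divr1 subrr mulr0 addr0.
  set S := sifted _ _ _ _ _.
  have ST : (S%:R : rat) <= T%:R.
    by rewrite ler_nat -[leqRHS](size_iota 0) count_size.
  have S0 : 0 <= (S%:R : rat) := ler0n _ _.
  have T0 : 0 <= (T%:R : rat) := ler0n _ _.
  by rewrite ler_norml; nra.
have cdlQ : all (coprime (d * l)) Q.
  apply/allP => q qQ; rewrite coprimeMl (allP cdQ) //= prime_coprime //.
  rewrite (dvdn_prime2 pl (allP pQ _ qQ)).
  by apply: contraNN lQ => /eqP ->.
(* By Buchstab's identity, the term for [Q] keeps the level r + 1, while the two removed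
   progressions are taken at level r. *)
have := IH uQ pQ cmQ r.+1 c d T cdQ.
have := IH uQ pQ cmQ r c1 (d * l)%N T1 cdlQ.
have := IH uQ pQ cmQ r c2 (d * l)%N T2 cdlQ.
rewrite E !natrD.
set S := sifted _ _ _ (_ :: _) _; set S1 := sifted _ c1 _ _ _.
set S2 := sifted _ c2 _ _ _.
have sieve_densityE : sieve_density (l :: Q) = (1 - 2 / l%:R) * sieve_density Q by rewrite /sieve_density big_cons.
have sieve_tailE : sieve_tail (l :: Q) = (1 + 4 / l%:R) * sieve_tail Q by rewrite /sieve_tail big_cons.
move: HlQ v0 v1; rewrite sieve_densityE sieve_tailE => HlQ _ _.
set V := sieve_density Q in vq0 vq1 *; set H := sieve_tail Q in HQ HlQ *.
set s := (size Q)%:R : rat.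
have -> : (size (l :: Q))%:R = s + 1 :> rat by rewrite /= -natr1.
have s0 : 0 <= s := ler0n _ _.
have := b1; have := b1'; have := b2; have := b2'.
rewrite -!(ler_nat rat) !natrD !natrM.
set i := (l%:R : rat)^-1.
have i0 : 0 <= i by rewrite invr_ge0 ltW.
have li : l%:R * i = 1 by rewrite mulfV ?gt_eqF.
have bnd (x : rat) : l%:R * x <= T%:R + l%:R -> T%:R <= l%:R * x + l%:R ->
   x <= T%:R * i + 1 /\ T%:R * i <= x + 1.
  move=> h1 h2; split; [have := ler_wpM2r i0 h1|have := ler_wpM2r i0 h2];
   rewrite mulrDl li (mulrC _ x) -mulrA li; lra.
move=> /bnd h2 /h2 [u2 l2] /bnd h1 /h1 [u1 l1]; rewrite {h1 h2}.
have T0 : 0 <= (T%:R : rat) := ler0n _ _.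
have T10 : 0 <= (T1%:R : rat) := ler0n _ _.
have T20 : 0 <= (T2%:R : rat) := ler0n _ _.
move: (T%:R : rat) (T1%:R : rat) (T2%:R : rat) T0 T10 T20 u1 u2 l1 l2
  (S%:R : rat) (S1%:R : rat) (S2%:R : rat) => t x1 x2 t0 x10 x20 u1 u2 l1 l2 S' S1' S2'.
set F := (2 * s + 2) ^+ r.
have F1 : 1 <= F by rewrite exprn_ege1 //; lra.
have eF : (2 * s + 2) ^+ r.+1 = (2 * s + 2) * F by rewrite exprS.
(* This is why the base is [2 * size Q + 2]: one more prime raises it by 2, which absorbs the
   rounding errors of the two removed progressions. *)
have gF : (2 * s + 2) * F + 2 * F <= (2 * (s + 1) + 2) ^+ r.+1.
  rewrite exprS -mulrDl (_ : 2 * s + 2 + 2 = 2 * (s + 1) + 2); last by ring.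
  rewrite ler_wpM2l //; first by lra.
  by rewrite lerXn2r ?nnegrE //; lra.
rewrite eF.
set G := (2 * (s + 1) + 2) ^+ r.+1 in gF *.
rewrite exprS invfM.
have : 0 <= (2 ^+ r)^-1 :> rat by rewrite invr_ge0 exprn_ge0.
have : (2 ^+ r)^-1 <= 1 :> rat by rewrite invf_le1 ?exprn_ege1 ?exprn_gt0.
move: ((2 ^+ r)^-1 : rat) => w w1 w0 A2 A1 A0.
have Hw : H * w <= H by nra.
(* Replacing the length [x] by [t * i] costs at most 1 in the main term and [H * w <= H] in the
   error term, so [(1 + H) * (F - 1)] becomes [(1 + H) * F]. *)
have key (x Sx : rat) : 0 <= x -> x <= t * i + 1 -> t * i <= x + 1 ->
   `|Sx - x * V| <= x * (H * w) + (1 + H) * (F - 1) ->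
   `|Sx - t * i * V| <= t * i * (H * w) + (1 + H) * F.
  move=> x0 xu xl hx.
  have -> : Sx - t * i * V = (Sx - x * V) + (x - t * i) * V by ring.
  apply: le_trans (ler_normD _ _) _.
  have : `|(x - t * i) * V| <= 1.
    by rewrite normrM mulr_ile1 // ?normr_ge0 // ?(ger0_norm vq0) // ler_norml; lra.
  have : x * (H * w) <= (t * i + 1) * (H * w) by rewrite ler_wpM2r // mulr_ge0 //; lra.
  nra.
have K1 := key _ _ x10 u1 l1 A1; have K2 := key _ _ x20 u2 l2 A2.
have -> : S' - t * ((1 - 2 * i) * V) =
   (S' + S1' + S2' - t * V) - (S1' - t * i * V) - (S2' - t * i * V) by ring.
apply: le_trans (ler_normB _ _) _.
apply: le_trans (lerD (ler_normB _ _) K2) _.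
apply: le_trans (lerD (lerD A0 K1) (lexx _)) _.
have -> : t * ((1 + 4 * i) * H * (2^-1 * w)) = t * (H * (2^-1 * w)) + 2 * (t * i * (H * w)) by field.
have : (1 + H) * ((2 * s + 2) * F - 1) + 2 * ((1 + H) * F) <= (1 + H) * (G - 1) by nra.
have iH : 0 <= i * H by rewrite mulr_ge0 //; lra.
have : (1 + H) * (G - 1) <= (1 + (1 + 4 * i) * H) * (G - 1).
  rewrite ler_wpM2r //; first nra.
  by rewrite mulrDl mul1r -mulrA; lra.
lra.
Qed.

Local Close Scope ring_scope.

(** * Chebyshev's bounds *)

(** The interval is half-open, m < p <= n, so that adjacent ranges concatenate. *)
Definition primes_in (m n : nat) : seq nat := [seq p <- index_iota m.+1 n.+1 | prime p].

Lemma mem_primes_in m n p : (p \in primes_in m n) = [&& prime p, m < p & p <= n].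
Proof. by rewrite mem_filter mem_index_iota ltnS. Qed.

Lemma primes_in_uniq m n : uniq (primes_in m n).
Proof. by rewrite filter_uniq // iota_uniq. Qed.

Lemma primes_in_prime m n : all prime (primes_in m n).
Proof. exact: filter_all. Qed.

Lemma primes_in_cat l m n : l <= m -> m <= n ->
  primes_in l n = primes_in l m ++ primes_in m n.
Proof.
move=> lm mn; rewrite /primes_in -filter_cat.
rewrite /index_iota (_ : n.+1 - l.+1 = (m.+1 - l.+1) + (n.+1 - m.+1)); last by lia.
by rewrite iotaD (_ : l.+1 + (m.+1 - l.+1) = m.+1) //; lia.
Qed.

Lemma prod_primes_dvdn (s : seq nat) n : uniq s -> all prime s ->
  {in s, forall p, p %| n} -> \prod_(p <- s) p %| n.
Proof.
elim: s => [|p s IH] /=; first by rewrite big_nil dvd1n.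
move=> /andP[ps us] /andP[pp aps] h; rewrite big_cons Gauss_dvd.
  by rewrite h ?mem_head // IH // => q qs; rewrite h // inE qs orbT.
rewrite prime_coprime // Euclid_dvd_prod // big_has.
apply/hasPn => q qs /=; rewrite (dvdn_prime2 pp (allP aps _ qs)).
by apply: contraNneq ps => ->.
Qed.

Lemma expn_size_leq_prod (T : eqType) (s : seq T) (F : T -> nat) n :
  {in s, forall x, n <= F x} -> n ^ size s <= \prod_(x <- s) F x.
Proof.
elim: s => [|x s IH] h; first by rewrite big_nil.
rewrite big_cons expnS leq_mul ?h ?mem_head // IH // => y ys.
by rewrite h // inE ys orbT.
Qed.

Lemma prod_leq_expn_size (T : eqType) (s : seq T) (F : T -> nat) n :
  {in s, forall x, F x <= n} -> \prod_(x <- s) F x <= n ^ size s.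
Proof.
elim: s => [|x s IH] h; first by rewrite big_nil.
rewrite big_cons expnS leq_mul ?h ?mem_head // IH // => y ys.
by rewrite h // inE ys orbT.
Qed.

Lemma leq_bin_double n : 2 ^ n <= 'C(n.*2, n).
Proof.
elim: n => // n IH; rewrite expnS doubleS binS mul2n.
have -> : 'C(n.*2.+1, n.+1) = 'C(n.*2.+1, n).
  have le : n.+1 <= n.*2.+1 by rewrite ltnS -addnn leq_addr.
  by rewrite -(bin_sub le) subSS -addnn addnK.
rewrite addnn leq_double (leq_trans IH) //.
by case: n {IH} => // n; rewrite doubleS binS leq_addr.
Qed.

Lemma bin_double_leq n : 'C(n.*2, n) <= 2 ^ n.*2.
Proof.
have -> : 2 ^ n.*2 = \sum_(i < n.*2.+1) 'C(n.*2, i).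
  by rewrite -[2]/(1 + 1) expnDn; apply: eq_bigr => i _; rewrite !exp1n !muln1.
have hn : n < n.*2.+1 by lia.
by rewrite (bigD1 (Ordinal hn)) //= leq_addr.
Qed.

(** A prime in (n, 2n] divides (2n)! but not n!, hence divides the central binomial coefficient,
    which is at most 4^n. *)
Lemma leq_expn_primes_in n : n ^ size (primes_in n n.*2) <= 2 ^ n.*2.
Proof.
apply: leq_trans (bin_double_leq n).
apply: (@leq_trans (\prod_(p <- primes_in n n.*2) p)).
  by apply: expn_size_leq_prod => p; rewrite mem_primes_in => /and3P[_ /ltnW].
apply: dvdn_leq; first by rewrite bin_gt0; lia.
apply: prod_primes_dvdn; [exact: primes_in_uniq|exact: primes_in_prime|].
move=> p; rewrite mem_primes_in => /and3P[pp np pn].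
have : p %| n.*2`! by rewrite dvdn_fact // prime_gt0.
have n2 : n <= n.*2 by lia.
rewrite -(bin_fact n2) Euclid_dvdM // (_ : n.*2 - n = n); last by lia.
case/orP => //; rewrite Euclid_dvdM // orbb => h; exfalso.
move: np; rewrite ltnNge => /negP; apply; move: h {pn n2}.
elim: n => [|n IH]; first by rewrite fact0 dvdn1 => /eqP p1; rewrite p1 in pp.
by rewrite factS Euclid_dvdM // => /orP[/dvdn_leq ->//|/IH /leqW].
Qed.

(** In Legendre's formula, the k-th term floor(2n / p^k) - 2 floor(n / p^k) is 0 or 1, and it
    vanishes once p^k > 2n. *)
Lemma logn_bin_double p n : prime p -> 0 < n ->
  logn p 'C(n.*2, n) <= trunc_log p n.*2.
Proof.
move=> pp n_gt0; set L := trunc_log _ _.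
have p1 := prime_gt1 pp.
have n2 : n <= n.*2 by lia.
have := congr1 (logn p) (bin_fact n2).
rewrite (_ : n.*2 - n = n); last by lia.
rewrite lognM ?bin_gt0 ?muln_gt0 ?fact_gt0 // lognM ?fact_gt0 //.
have -> : logn p n`! = \sum_(1 <= k < n.*2.+1) n %/ p ^ k.
  rewrite logn_fact // [RHS](big_cat_nat _ (n := n.+1)) //=.
  rewrite [X in _ = _ + X]big_nat_cond [X in _ = _ + X]big1 ?addn0 // => k.
  rewrite andbT => /andP[nk _]; apply: divn_small.
  by apply: (leq_trans nk); apply: ltnW; apply: ltn_expl.
rewrite logn_fact // addnn => e.
have sumL m : \sum_(1 <= k < m.+1) (k <= L) <= L.
  elim: m => [|m IH]; first by rewrite big_geq.
  case: (leqP m.+1 L) => mL; last by rewrite big_nat_recr //= (leqNgt m.+1) mL addn0.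
  apply: leq_trans (_ : \sum_(1 <= k < m.+2) 1 <= _).
    by apply: leq_sum => k _; apply: leq_b1.
  by rewrite sum_nat_const_nat muln1 subn1.
suff : \sum_(1 <= k < n.*2.+1) n.*2 %/ p ^ k <=
   (\sum_(1 <= k < n.*2.+1) n %/ p ^ k).*2 + \sum_(1 <= k < n.*2.+1) (k <= L).
  have := sumL n.*2; lia.
rewrite -(mul2n (\sum_(_ <= _ < _) _)) big_distrr /= -big_split /=.
rewrite big_nat_cond [leqRHS]big_nat_cond; apply: leq_sum => k.
rewrite andbT => /andP[k1 _].
have q_gt0 : 0 < p ^ k by rewrite expn_gt0 ltnW.
case: (leqP k L) => kL.
  have := divn_eq n (p ^ k); have := ltn_pmod n q_gt0.
  move: (n %/ _) (n %% _) => q r hr ->.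
  rewrite -ltnS ltn_divLR //; nia.
rewrite divn_small // (leq_trans (trunc_log_ltn _ p1)) //.
by rewrite leq_exp2l.
Qed.

(** The central binomial coefficient is a product of prime powers, one for each prime dividing it;
    all these primes and, by [logn_bin_double], all these powers are at most 2n. *)
Lemma expn_primes_in_geq n : 0 < n -> 2 ^ n <= n.*2 ^ size (primes_in 0 n.*2).
Proof.
move=> n_gt0; apply: leq_trans (leq_bin_double n) _.
set c := 'C(_, _).
have c_gt0 : 0 < c by rewrite bin_gt0; lia.
rewrite {1}[c]prod_prime_decomp // prime_decompE big_map /=.
have sub : {subset primes c <= primes_in 0 n.*2}.
  move=> p; rewrite mem_primes mem_primes_in => /and3P[pp _ pc].
  rewrite pp prime_gt0 //=.
  have : p %| n.*2`!.
    have n2 : n <= n.*2 by lia.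
    by rewrite -(bin_fact n2) dvdn_mulr.
  elim: (n.*2) => [|m IH]; first by rewrite fact0 dvdn1 => /eqP p1; rewrite p1 in pp.
  by rewrite factS Euclid_dvdM // => /orP[/dvdn_leq ->//|/IH /leqW].
apply: (@leq_trans (n.*2 ^ size (primes c))); last first.
  by rewrite leq_pexp2l ?uniq_leq_size ?primes_uniq //; lia.
apply: prod_leq_expn_size => p; rewrite mem_primes => /and3P[pp _ _].
apply: leq_trans (trunc_logP (prime_gt1 pp) _); last by lia.
by rewrite leq_exp2l ?prime_gt1 // logn_bin_double.
Qed.

Lemma size_primes_in_pow2_geq K : 0 < K -> 2 ^ K <= K.*2 * size (primes_in 0 (2 ^ K)).
Proof.
case: K => // K _; have := @expn_primes_in_geq (2 ^ K) (expn_gt0 2 K).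
rewrite -mul2n -expnS -expnM leq_exp2l // expnS => h.
by rewrite -muln2 (mulnC _ 2) -mulnA leq_mul2l h orbT.
Qed.

Lemma size_primes_in_dyadic i : i * size (primes_in (2 ^ i) (2 ^ i.+1)) <= 2 ^ i.+1.
Proof.
have := leq_expn_primes_in (2 ^ i).
by rewrite -mul2n -expnS -expnM leq_exp2l.
Qed.

Lemma size_primes_in_pow2_leq J : J * size (primes_in 0 (2 ^ J)) <= 6 * 2 ^ J.
Proof.
case: J => // J; elim: J => // J IH; case: J IH => // J IH.
have h2 := size_primes_in_dyadic J.+2; move: IH.
rewrite (@primes_in_cat 0 (2 ^ J.+2) (2 ^ J.+3)) // ?leq_exp2l // size_cat.
rewrite (expnS 2 J.+2) in h2 *.
move: (size _) (size _) h2 => x y; move: (2 ^ _) => Z hy hx.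
have h8 : J.+2 * (x + y) <= 8 * Z by rewrite mulnDr; lia.
(* The constant 6 is the least for which this induction step closes; equality holds at [J = 0]. *)
have h12 : J.+3 * (8 * Z) <= J.+2 * (6 * (2 * Z)) by nia.
rewrite -(@leq_pmul2l J.+2) //; apply: leq_trans h12.
by rewrite mulnCA leq_mul2l h8 orbT.
Qed.

(** * Mertens-type estimates at powers of two *)

Local Open Scope ring_scope.

(** Each dyadic block of the harmonic sum contributes at most 1; the companion bound below uses that
    it contributes at least 1/2. *)
Lemma harmonic_pow2_leq j : \sum_(1 <= i < 2 ^ j) (i%:R^-1 : rat) <= j%:R.
Proof.
elim: j => [|j IH]; first by rewrite big_geq.
rewrite (@big_cat_nat _ _ _ (2 ^ j)) ?expn_gt0 ?leq_exp2l //=.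
rewrite -natr1 lerD //.
have p0 : 0 < ((2 ^ j)%N%:R : rat) by rewrite ltr0n expn_gt0.
apply: (@le_trans _ _ (\sum_(2 ^ j <= i < 2 ^ j.+1) ((2 ^ j)%N%:R^-1 : rat))).
  rewrite [leLHS]big_nat_cond [leRHS]big_nat_cond; apply: ler_sum => i.
  rewrite andbT => /andP[h _]; rewrite lef_pV2 ?ler_nat // posrE //.
  by rewrite ltr0n (leq_trans _ h) // expn_gt0.
rewrite sumr_const_nat expnS mul2n -addnn addnK -(mulr_natl _^-1) mulfV //.
exact: lt0r_neq0.
Qed.

Lemma harmonic_pow2_geq j : j%:R / 2 <= \sum_(1 <= i < 2 ^ j) (i%:R^-1 : rat).
Proof.
elim: j => [|j IH]; first by rewrite big_geq // mul0r.
rewrite (@big_cat_nat _ _ _ (2 ^ j)) ?expn_gt0 ?leq_exp2l //=.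
rewrite -natr1 mulrDl lerD // mul1r.
have p0 : 0 < ((2 ^ j)%N%:R : rat) by rewrite ltr0n expn_gt0.
apply: (@le_trans _ _ (\sum_(2 ^ j <= i < 2 ^ j.+1) ((2 ^ j.+1)%N%:R^-1 : rat))); last first.
  rewrite [leLHS]big_nat_cond [leRHS]big_nat_cond; apply: ler_sum => i.
  rewrite andbT => /andP[h h'].
  have i0 : (0 < i)%N by rewrite (leq_trans _ h) // expn_gt0.
  by rewrite lef_pV2 ?posrE ?ltr0n ?expn_gt0 // ler_nat ltnW.
rewrite sumr_const_nat expnS mul2n -addnn addnK -(mulr_natl _^-1) addnn -mul2n natrM.
by rewrite invfM mulrCA mulfV ?mulr1 // lt0r_neq0.
Qed.

Lemma ler_sum_subset (T : eqType) (s1 s2 : seq T) (F : T -> rat) : uniq s1 ->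
  {subset s1 <= s2} -> (forall x, 0 <= F x) ->
  \sum_(x <- s1) F x <= \sum_(x <- s2) F x.
Proof.
elim: s1 s2 => [|x s IH] s2; first by move=> _ _ h; rewrite big_nil sumr_ge0.
move=> /= /andP[xs us] sub F0.
rewrite (perm_big _ (perm_to_rem (sub x (mem_head x s)))) !big_cons lerD2l.
apply: IH => // y ys; have yx : y != x by apply: contraNneq xs => <-.
have := sub y; rewrite inE ys orbT => /(_ isT) y2.
by have := perm_mem (perm_to_rem (sub x (mem_head x s))) y; rewrite y2 inE (negbTE yx) => /esym.
Qed.

(** By the dyadic Chebyshev bound, the primes in (2^i, 2^(i+1)] contribute at most 2 / i. The sum
    starts above 2 to avoid the block i = 0. *)
Lemma sum_inv_primes_leq j :
  \sum_(p <- primes_in 2 (2 ^ (2 ^ j))) (p%:R^-1 : rat) <= 2 * j%:R.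
Proof.
apply: (@le_trans _ _ (2 * \sum_(1 <= i < 2 ^ j) (i%:R^-1 : rat))); last first.
  by rewrite ler_wpM2l // harmonic_pow2_leq.
have : (0 < 2 ^ j)%N by rewrite expn_gt0.
case: (2 ^ j)%N => // J _; elim: J => [|J IH].
  by rewrite big_geq // mulr0 (_ : primes_in _ _ = [::]) // big_nil.
rewrite big_nat_recr //= mulrDr (@primes_in_cat 2 (2 ^ J.+1) (2 ^ J.+2)) ?leq_exp2l //; last first.
  by rewrite -{1}[2%N]expn1 leq_exp2l.
rewrite big_cat /= lerD //.
have p0 : 0 < ((2 ^ J.+1)%N%:R : rat) by rewrite ltr0n expn_gt0.
apply: (@le_trans _ _ (\sum_(p <- primes_in (2 ^ J.+1) (2 ^ J.+2)) ((2 ^ J.+1)%N%:R^-1 : rat))).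
  rewrite [leLHS]big_seq [leRHS]big_seq; apply: ler_sum => p.
  rewrite mem_primes_in => /and3P[pp h _].
  have p_gt0 := prime_gt0 pp.
  by rewrite lef_pV2 ?posrE ?ltr0n ?expn_gt0 // ler_nat ltnW.
rewrite big_const_seq count_predT iter_addr_0 -(mulr_natl _^-1) ler_pdivrMr //.
rewrite mulrAC ler_pdivlMr ?ltr0n // -!natrM ler_nat mulnC.
by rewrite -expnS; exact: size_primes_in_dyadic.
Qed.

(** A rational substitute for bounding the product by the exponential of the sum. *)
Lemma prod_1D_leq (s : seq nat) (F : nat -> rat) (n : nat) : (0 < n)%N ->
  (forall x, 0 <= F x) -> \sum_(x <- s) F x <= n%:R / 2 ->
  \prod_(x <- s) (1 + F x) <= 2 ^+ n.
Proof.
move=> n_gt0 F0 hs.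
have nR : 0 < (n%:R : rat) by rewrite ltr0n.
(* (1 + F x) <= (1 + F x / n)^n, and prod (1 + G x) <= 1 / (1 - sum G x) <= 2. *)
pose G x := F x / n%:R.
have G0 x : 0 <= G x by rewrite divr_ge0 // ltW.
have bern (a : rat) k : 0 <= a -> 1 + k%:R * a <= (1 + a) ^+ k.
  move=> a0; elim: k => [|k IH]; first by rewrite mul0r addr0.
  have k0 : 0 <= (k%:R : rat) by [].
  have ka : 0 <= (k%:R : rat) * a by rewrite mulr_ge0.
  rewrite exprS -natr1; nra.
apply: (@le_trans _ _ ((\prod_(x <- s) (1 + G x)) ^+ n)).
  rewrite -prodrXl; apply: ler_prod => x _.
  rewrite addr_ge0 //=; apply: le_trans (bern _ _ (G0 x)).
  by rewrite /G mulrC divfK // gt_eqF.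
have GS : \sum_(x <- s) G x <= 1 / 2.
  by rewrite -mulr_suml ler_pdivrMr // mulrC mulrA mulr1.
rewrite lerXn2r ?nnegrE //; first by apply: prodr_ge0 => x _; rewrite addr_ge0.
suff : \prod_(x <- s) (1 + G x) * (1 - \sum_(x <- s) G x) <= 1.
  have : 1 <= \prod_(x <- s) (1 + G x).
    elim: (s) => [|x t IH]; first by rewrite big_nil.
    by rewrite big_cons -[leLHS]mulr1 ler_pM // lerDl.
  nra.
elim: (s) => [|x t IH]; first by rewrite !big_nil subr0 mulr1.
rewrite !big_cons.
have : 0 <= \prod_(x <- t) (1 + G x) by apply: prodr_ge0 => y _; rewrite addr_ge0.
have : 0 <= \sum_(x <- t) G x by apply: sumr_ge0.
move: IH (G0 x) => /[swap]; move: (\prod_(_ <- t) _) (\sum_(_ <- t) _) (G x) => P S g g0 h S0 P0.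
have : 0 <= P * g * (g + S) by rewrite !mulr_ge0 // addr_ge0.
lra.
Qed.

Definition smooth_over (L : seq nat) (n : nat) := all [in L] (primes n).

(** A finite form of the Euler product; it converts the growth of the harmonic sum into an upper
    bound for the product of the 1 - 1/l. *)
Lemma sum_inv_smooth_leq (L : seq nat) (N : nat) : all prime L ->
  \prod_(l <- L) (1 - l%:R^-1) *
    \sum_(1 <= n < N.+1 | smooth_over L n) (n%:R^-1 : rat) <= 1.
Proof.
elim: L => [|l L IH].
  move=> _; rewrite big_nil mul1r big_mkcond; case: N => [|N]; first by rewrite big_geq.
  rewrite big_nat_recl //= invr1 big_nat_cond big1 ?addr0 // => i.
  rewrite andbT => /andP[i1 _]; case: ifP => // /allP h.
  by have := h (pdiv i.+1); rewrite mem_primes pdiv_prime // pdiv_dvd /= => /(_ isT).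
move=> /= /andP[pl pL]; have {IH} := IH pL.
have l0 : 0 < (l%:R : rat) by rewrite ltr0n prime_gt0.
rewrite big_cons -mulrA mulrCA.
set S := \sum_(_ <= _ < _ | smooth_over L _) _.
set S' := \sum_(_ <= _ < _ | _) _ => h.
(* The multiples of l contribute at most S' / l, by n |-> n / l. *)
have key : S' <= S + l%:R^-1 * S'.
  rewrite {1}/S' (bigID (fun n => l %| n)%N) /= addrC; apply: lerD.
    rewrite /S big_mkcond [leRHS]big_mkcond; apply: ler_sum => n _.
    case: ifP => [/andP[/allP sm ln]|_]; last by case: ifP => // _; rewrite invr_ge0.
    rewrite ifT //; apply/allP => p pn; have := sm p pn.
    rewrite inE => /orP[/eqP pl'|//].
    by move: pn; rewrite mem_primes pl' (negbTE ln) !andbF.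
  rewrite /S' -big_filter -[X in _ * X]big_filter big_distrr /=.
  set s := [seq n <- _ | smooth_over _ _].
  have -> : \sum_(n <- s) (l%:R^-1 * n%:R^-1 : rat) = \sum_(n <- map (muln l) s) n%:R^-1.
    by rewrite big_map; apply: eq_bigr => n _; rewrite natrM invfM.
  apply: ler_sum_subset => [|n|n]; last by rewrite invr_ge0.
    by rewrite filter_uniq // iota_uniq.
  rewrite mem_filter mem_index_iota => /andP[/andP[/allP sm /dvdnP[q nq]] /andP[n1 nN]].
  have l1 := prime_gt0 pl.
  have q1 : (0 < q)%N by rewrite lt0n; apply: contraTneq n1 => q0; rewrite nq q0.
  apply/mapP; exists q; last by rewrite nq mulnC.
  rewrite mem_filter mem_index_iota q1 /=; apply/andP; split; last first.
    by rewrite (leq_ltn_trans _ nN) // nq leq_pmulr.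
  apply/allP => p pq; apply: sm; move: pq; rewrite !mem_primes n1 => /and3P[-> _ pq].
  by rewrite nq dvdn_mulr.
apply: le_trans h.
have P0 : 0 <= \prod_(l <- L) (1 - (l%:R^-1 : rat)).
  rewrite big_seq; apply: prodr_ge0 => p pL'.
  by rewrite subr_ge0 invf_le1 ?ler1n ?ltr0n prime_gt0 // (allP pL).
by rewrite ler_wpM2l //; lra.
Qed.

Local Close Scope ring_scope.

(** * Primes p with p + 1 free of large prime factors *)

Local Open Scope ring_scope.

(** The sum of the 4 / l is at most 8j, which is half of the exponent 16j. *)
Lemma sieve_tail_primes_in_leq w j : (2 <= w)%N -> (0 < j)%N ->
  sieve_tail (primes_in w (2 ^ (2 ^ j))) <= 2 ^+ (16 * j).
Proof.
move=> w2 j0; apply: prod_1D_leq => [|x|]; first by lia.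
  by rewrite divr_ge0.
rewrite -mulr_sumr natrM.
suff : \sum_(p <- primes_in w (2 ^ (2 ^ j))) (p%:R^-1 : rat) <= 2 * j%:R by lra.
apply: le_trans (sum_inv_primes_leq j); apply: ler_sum_subset => [|p|p].
- exact: primes_in_uniq.
- by rewrite !mem_primes_in => /and3P[-> /(leq_ltn_trans w2) -> ->].
- by rewrite invr_ge0.
Qed.

Lemma size_primes_in_leq m n : (size (primes_in m n) <= n - m)%N.
Proof. by rewrite size_filter (leq_trans (count_size _ _)) // size_iota; lia. Qed.

(** Each factor is at least 1/2. Such a crude bound is enough because [w] stays fixed while [j] can
    be taken large. *)
Lemma prod_1B_primes_in_geq w :
  (2^-1) ^+ w <= \prod_(l <- primes_in 0 w) (1 - l%:R^-1 : rat).
Proof.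
elim: w => [|w IH]; first by rewrite big_nil.
rewrite (@primes_in_cat 0 w w.+1) // big_cat /= exprSr.
apply: ler_pM => //.
  by rewrite exprn_ge0.
rewrite /primes_in /index_iota subSS subSn // subnn /=.
case: ifP => [pw|_]; last by rewrite big_nil; lra.
rewrite big_seq1.
have : (w.+1%:R^-1 : rat) <= 2^-1 by rewrite lef_pV2 ?posrE // ler_nat prime_gt1.
move: (w.+1%:R^-1) => x; lra.
Qed.

(** Since 1 - 2/l <= (1 - 1/l)^2, it suffices to bound the product [P] of the 1 - 1/l. Every n <=
    2^J is smooth over the primes up to 2^J, so the Euler product gives [P * J <= 2 ^+ w.+1], the
    factor 2^w paying for the primes up to [w]. *)
Lemma sieve_density_primes_in_leq w j : (w <= 2 ^ (2 ^ j))%N ->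
  sieve_density (primes_in w (2 ^ (2 ^ j))) <= 2 ^+ (2 * w + 2) / 2 ^+ (2 * j).
Proof.
set J := (2 ^ j)%N => wJ; set Q := primes_in _ _.
pose P : rat := \prod_(l <- Q) (1 - l%:R^-1).
have P0 : 0 <= P.
  rewrite /P big_seq; apply: prodr_ge0 => p; rewrite mem_primes_in => /andP[pp _].
  by rewrite subr_ge0 invf_le1 ?ler1n ?ltr0n prime_gt0.
have J0 : 0 < (J%:R : rat) by rewrite ltr0n expn_gt0.
have PJ : P * J%:R <= 2 ^+ w.+1.
  have := sum_inv_smooth_leq (2 ^ J) (primes_in_prime 0 (2 ^ J)).
  rewrite (@primes_in_cat 0 w) // big_cat -/Q /= -/P -(@primes_in_cat 0 w) //.
  set W := \prod_(_ <- _) _; set S := \sum_(_ <= _ < _ | _) _.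
  have hW : (2^-1) ^+ w <= W := prod_1B_primes_in_geq w.
  have hS : J%:R / 2 <= S.
    apply: le_trans (harmonic_pow2_geq J) _.
    have -> : S = \sum_(1 <= n < (2 ^ J).+1) (n%:R^-1 : rat).
      rewrite /S [LHS]big_nat_cond [RHS]big_nat_cond; apply: eq_bigl => n.
      case: (boolP (0 < n < _)%N) => //= /andP[n1 nJ]; apply/allP => p.
      rewrite mem_primes => /and3P[pp _ /(dvdn_leq n1) pn].
      by rewrite mem_primes_in pp prime_gt0 //= (leq_trans pn).
    by rewrite big_nat_recr ?expn_gt0 //= lerDl invr_ge0.
  move=> h.
  have h2 : (2^-1) ^+ w * P * (J%:R / 2) <= 1.
    apply: le_trans h; rewrite ler_pM ?mulr_ge0 ?exprn_ge0 ?invr_ge0 //.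
    by rewrite ler_wpM2r.
  have e2 : 2 ^+ w * (2^-1) ^+ w = 1 :> rat by rewrite -exprMn mulfV // expr1n.
  have w0 : 0 < (2 : rat) ^+ w by rewrite exprn_gt0.
  have -> : P * J%:R = 2 ^+ w * 2 * ((2^-1) ^+ w * P * (J%:R / 2)).
    rewrite (_ : _ * 2 * _ = 2 ^+ w * (2^-1) ^+ w * P * J%:R); last by field.
    by rewrite e2 mul1r.
  by rewrite exprSr -[leRHS]mulr1 ler_wpM2l // mulr_ge0 // ltW.
apply: (@le_trans _ _ (P ^+ 2)).
  rewrite /sieve_density /P -prodrXl [leLHS]big_seq [leRHS]big_seq; apply: ler_prod => l.
  rewrite mem_primes_in => /andP[pl _].
  have : (2 : rat) <= l%:R by rewrite ler_nat prime_gt1.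
  rewrite -lef_pV2 ?posrE ?ltr0n ?prime_gt0 // => h.
  by apply/andP; split; nra.
rewrite ler_pdivlMr ?exprn_gt0 //.
have -> : 2 ^+ (2 * j) = (J%:R : rat) ^+ 2 by rewrite mulnC exprM natrX.
rewrite -exprMn (_ : 2 * w + 2 = w.+1 * 2)%N ?exprM; last by lia.
by rewrite lerXn2r ?nnegrE ?exprn_ge0 // mulr_ge0 // ltW.
Qed.

Definition prime_pairs (m X : nat) : seq nat :=
  [seq n <- iota 0 X | prime n && prime (m * n).-1].

(** Brun's sieve with the primes in (w, z], where z = 2^J and J = 2^j. Since log X is of order j
    2^j, the resulting bound O(X / 4^j) is o(X / log X) for fixed [w]. *)
Lemma size_prime_pairs_leq m w j : (0 < m)%N -> (m <= w)%N -> (2 <= w)%N ->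
  (w <= 2 ^ (2 ^ j))%N -> (0 < j)%N -> forall X, X = (2 ^ (64 * j * 2 ^ j))%N ->
  (size (prime_pairs m X))%:R * 2 ^+ (2 * j) <= X%:R * 2 ^+ (2 * w + 4) :> rat.
Proof.
move=> m0 mw w2 wJ j0 X defX.
(* [sieve_tail] is at most 2^(16j), so truncation at level 18j leaves the first error term at most X
   / 4^j. *)
set J := (2 ^ j)%N in wJ defX *; set z := (2 ^ J)%N in wJ *.
pose Q := primes_in w z; set r := (18 * j)%N.
have J2 : (2 <= J)%N by rewrite -[2%N]expn1 leq_exp2l.
(* The n < z + 2 are counted trivially, since there n or m n - 1 may itself be one of the sieving
   primes. *)
have zP : (size (prime_pairs m X) <= z.+2 + sifted m 0 1 Q X)%N.
  rewrite size_filter.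
  apply: (@leq_trans (count (fun n => n < z.+2)%N (iota 0 X) + sifted m 0 1 Q X)).
    rewrite -count_predUI (leq_trans _ (leq_addr _ _)) //.
    apply: sub_count => n /andP[pn pmn] /=; rewrite -implyNb -leqNgt; apply/implyP => zn.
    apply/allP => l; rewrite mem_primes_in add0n mul1n => /and3P[pl wl lz].
    apply/andP; split.
      by rewrite dvdn_prime2 //; apply: contraTneq zn => <-; rewrite -ltnNge; lia.
    have mn : (n <= m * n)%N by rewrite leq_pmull.
    have l1 := prime_gt1 pl.
    rewrite eqn_mod_dvd; last by lia.
    rewrite subn1 dvdn_prime2 //; apply/eqP; lia.
  rewrite leq_add2r -size_filter.
  apply: leq_trans (uniq_leq_size (s2 := iota 0 z.+2) _ _) _.
  - by rewrite filter_uniq // iota_uniq.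
  - by move=> n; rewrite mem_filter !mem_iota => /andP[].
  - by rewrite size_iota.
have uQ := primes_in_uniq w z; have pQ := primes_in_prime w z.
have cQ : all (coprime m) Q.
  apply/allP => l; rewrite mem_primes_in => /and3P[pl wl _].
  rewrite coprime_sym prime_coprime //; apply/negP => /(dvdn_leq m0); lia.
have c1 : all (coprime 1) Q by apply/allP => l _; rewrite coprime1n.
have := brun_sieve uQ pQ cQ r 0 X c1.
have := sieve_tail_primes_in_leq w2 j0; have := sieve_density_primes_in_leq wJ.
have := sieve_tail_ge1 Q; rewrite -/J -/z -/Q.
move: (sieve_density Q) (sieve_tail Q) => V H H1 hV hH hb.
have hS : (size Q <= z - w)%N := size_primes_in_leq w z.
have hs : 2 * (size Q)%:R + 2 <= (2 : rat) ^+ J.+1.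
  have : (2 * size Q + 2 <= 2 ^ J.+1)%N.
    rewrite expnS -/z; move: (size Q) (z) hS w2 wJ; clear; lia.
  by rewrite -(ler_nat rat) natrD natrM natrX.
have X0 : 0 <= (X%:R : rat) := ler0n _ _.
have XE : (X%:R : rat) = 2 ^+ (64 * j * J) by rewrite defX natrX.
have s0 : 0 <= ((size Q)%:R : rat) := ler0n _ _.
have tj0 : 0 < (2 : rat) ^+ (2 * j) by rewrite exprn_gt0.
have pow_leq a b : (a <= b)%N -> (2 : rat) ^+ a <= 2 ^+ b.
  by move=> ab; rewrite ler_weXn2l.
have e1 : X%:R * (H / 2 ^+ r) * 2 ^+ (2 * j) <= X%:R.
  rewrite -mulrA ger_pMr // ?(lt_le_trans _ (pow_leq 0 _ _)) //.
    rewrite mulrAC ler_pdivrMr ?exprn_gt0 // mul1r.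
    apply: le_trans (_ : 2 ^+ (16 * j) * 2 ^+ (2 * j) <= _).
      by rewrite ler_wpM2r // ltW.
    by rewrite -exprD -mulnDl pow_leq.
  by rewrite XE exprn_gt0.
(* The exponent 64 in [X] leaves room for this error: 16j + 1 + 18j (J + 1) + 2j <= 64 j J because J
   >= 2. *)
have e2 : (1 + H) * ((2 * (size Q)%:R + 2) ^+ r - 1) * 2 ^+ (2 * j) <= X%:R.
  apply: le_trans (_ : 2 ^+ (16 * j).+1 * (2 ^+ J.+1) ^+ r * 2 ^+ (2 * j) <= _).
    rewrite ler_wpM2r ?(ltW tj0) // ler_pM //.
    - by lra.
    - by rewrite subr_ge0 exprn_ege1 //; lra.
    - by rewrite exprS; have := pow_leq 0 (16 * j)%N isT; rewrite expr0; lra.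
    rewrite lerBlDr; apply: (@le_trans _ _ ((2 ^+ J.+1) ^+ r)); last by rewrite lerDl.
    by rewrite lerXn2r ?nnegrE ?exprn_ge0 // addr_ge0 // mulr_ge0.
  rewrite XE -exprM -!exprD pow_leq // /r.
  clear -J2 j0; move: J J2 => J J2.
  have : (j * 2 <= j * J)%N by rewrite leq_mul2l J2 orbT.
  rewrite (_ : J.+1 * (18 * j) = 18 * (j * J) + 18 * j)%N; last by ring.
  rewrite -(mulnA 64); move: (j * J)%N; lia.
have e3 : z.+2%:R * 2 ^+ (2 * j) <= (X%:R : rat).
  apply: le_trans (_ : 2 ^+ J.+2 * 2 ^+ (2 * j) <= _).
    rewrite ler_wpM2r ?(ltW tj0) // -natrX ler_nat !expnS -/z.
    move: (z) (leq_trans w2 wJ); clear; lia.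
  rewrite XE -exprD pow_leq //.
  clear -J2 j0; move: J J2 => J J2.
  have : (j * 2 <= j * J)%N by rewrite leq_mul2l J2 orbT.
  have : (1 * J <= j * J)%N by rewrite leq_mul2r j0 orbT.
  rewrite -(mulnA 64); move: (j * J)%N; lia.
have e4 : X%:R * V * 2 ^+ (2 * j) <= X%:R * 2 ^+ (2 * w + 2).
  by rewrite -mulrA ler_wpM2l // -ler_pdivlMr.
have e5 : (4 : rat) <= 2 ^+ (2 * w + 2) by apply: le_trans (pow_leq 2 (2 * w + 2) (leq_addl _ _))%N; rewrite expr2 -natrM.
have -> : (2 : rat) ^+ (2 * w + 4) = 4 * 2 ^+ (2 * w + 2).
  by rewrite (_ : 2 * w + 4 = (2 * w + 2) + 2)%N ?exprD; [ring | clear; lia].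
move: zP; rewrite -(ler_nat rat) natrD => zP.
apply: le_trans (ler_wpM2r (ltW tj0) zP) _.
move: hb; rewrite ler_distl => /andP[_ hb].
rewrite mulrDl.
move: hb e1 e2 e3 e4.
move: (X%:R * (H / _)) ((1 + H) * _) (X%:R * V) (sifted _ _ _ _ _)%:R => E1 E2 E4 S.
have : X%:R * 4 <= X%:R * 2 ^+ (2 * w + 2) :> rat by rewrite ler_wpM2l.
move: z.+2%:R => Z; rewrite mulrCA.
move: (X%:R * 2 ^+ _) => XW hXW hb e1 e2 e3 e4.
have := ler_wpM2r (ltW tj0) hb; rewrite 2!mulrDl; lra.
Qed.

Local Close Scope ring_scope.

Lemma double_leq_exp2 n : 0 < n -> 2 * n <= 2 ^ n.
Proof. by case: n => // n _; rewrite expnS leq_mul2l ltn_expl. Qed.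

Definition smooth_shift (y p : nat) := all (fun q => q <= y) (primes p.+1).

(** If a prime q > y divides p + 1, then p + 1 = m q with m <= X / y = 2^mu, and the pair (m, q)
    determines p. *)
Lemma size_not_smooth_shift_leq (B K mu c : nat) : 1 < K -> mu <= K ->
  (forall m, 0 < m <= 2 ^ mu -> size (prime_pairs m (2 ^ K)) <= c) ->
  size [seq p <- primes_in B (2 ^ K) | ~~ smooth_shift (2 ^ (K - mu)) p] <= 2 ^ mu * c.
Proof.
move=> K1 muK hc; set X := 2 ^ K; set y := 2 ^ (K - mu).
have X2 : 2 < X by rewrite (@leq_trans (2 ^ 2)) // leq_exp2l.
have Xy : X = 2 ^ mu * y by rewrite -expnD subnKC.
have y0 : 0 < y by rewrite expn_gt0.
(* As [X] is not prime, p <= X gives p + 1 <= X, which keeps m and q within range. *)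
have Xprime : ~~ prime X.
  apply/negP => pX; have : 2 %| X by rewrite /X dvdn_exp // ltnW.
  by rewrite dvdn_prime2 // => /eqP e; rewrite -e in X2.
pose s := flatten [seq [seq (m * q).-1 | q <- prime_pairs m X] | m <- iota 1 (2 ^ mu)].
apply: (@leq_trans (size s)).
  apply: uniq_leq_size; first by rewrite filter_uniq // primes_in_uniq.
  move=> p; rewrite mem_filter mem_primes_in => /andP[/allPn[q]].
  rewrite mem_primes -ltnNge => /and3P[pq _ /dvdnP[m em]] yq /and3P[pp Bp pX].
  have pltX : p < X by rewrite ltn_neqAle pX andbT; apply: contraNneq Xprime => <-.
  have m0 : 0 < m by rewrite lt0n; apply/eqP => m0; rewrite m0 in em.
  have qltX : q < X.
    rewrite ltn_neqAle; apply/andP; split; first by apply: contraNneq Xprime => <-.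
    by rewrite (leq_trans _ pltX) // em leq_pmull.
  apply/flattenP; exists [seq (m * q).-1 | q <- prime_pairs m X].
    apply/mapP; exists m => //; rewrite mem_iota m0 add1n ltnS -(leq_pmul2r y0) -Xy.
    have : m * y.+1 <= m * q by rewrite leq_mul2l yq orbT.
    rewrite -em mulnS; lia.
  apply/mapP; exists q; last by rewrite -em.
  by rewrite mem_filter mem_iota pq -em /= pp add0n qltX.
rewrite size_flatten /shape -map_comp sumnE big_map.
rewrite -[X in X * c](size_iota 1) -[leqRHS]/(_ * c)%N.
rewrite big_seq (@leq_trans (\sum_(m <- iota 1 (2 ^ mu) | m \in iota 1 (2 ^ mu)) c)) //.
  apply: leq_sum => m; rewrite mem_iota add1n ltnS /= size_map => h.
  exact: hc.
by rewrite -big_seq big_const_seq count_predT iter_addn_0 mulnC.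
Qed.

(** There are at least X / (2K) primes up to X = 2^K. The primes up to [B], the discarded primes and
    the required [C * (size (primes_in 0 y) + D)] are each a small fraction of X / K. *)
Lemma smooth_shifted_primes (B C D : nat) : exists y (s : seq nat),
  [/\ uniq s, {in s, forall p, prime p && (B < p)},
      {in s, forall p, smooth_shift y p} &
      C * (size (primes_in 0 y) + D) <= size s].
Proof.
(* With y = X / M and pi(y) <= 12 y / K, the bound M >= 96 C gives C pi(y) <= X / (8K). *)
pose mu := 96 * C + 1; pose M := 2 ^ mu.
have M96 : 96 * C <= M by rewrite (leq_trans (ltnW (ltn_expl _ (ltnSn 1)))) // leq_exp2l // leq_addr.
have M2 : 2 <= M by rewrite -[2]expn1 leq_exp2l // /mu addn1.
(* The summands up to 13 serve [hbad], where 8 * 64 * M * 2^(2M+4) = 2^(mu+2M+13) has to be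
   absorbed; the last one serves [hKD]. Taking j = 2e splits 2^j as 2^e * 2^e, one factor exceeding
   j and the other this constant. *)
pose e := mu + 2 * M + 13 + 16 * (C * D + B); pose j := 2 * e.
pose K := 64 * j * 2 ^ j.
have j0 : 0 < j by rewrite /j /e; lia.
have muj : mu <= j by rewrite /j /e; lia.
have jJ : j <= 2 ^ j by rewrite ltnW // ltn_expl.
have MJ : M <= 2 ^ (2 ^ j) by rewrite leq_exp2l // (leq_trans muj).
have Kj : 64 * j <= K by rewrite /K leq_pmulr // expn_gt0.
have K1 : 1 < K by lia.
have muK : 2 * mu <= K by lia.
pose X := 2 ^ K; pose y := 2 ^ (K - mu).
exists y, [seq p <- primes_in B X | smooth_shift y p].
split.
- by rewrite filter_uniq // primes_in_uniq.
- by move=> p; rewrite mem_filter mem_primes_in => /and4P[_ -> ->].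
- by move=> p; rewrite mem_filter => /andP[].
set s := [seq _ <- _ | _].
pose c := \max_(1 <= m < M.+1) size (prime_pairs m X).
have hc m : 0 < m <= M -> size (prime_pairs m X) <= c.
  by move=> hm; rewrite /c (@leq_bigmax_seq _ _ xpredT (fun m => size (prime_pairs m X)) m) // mem_index_iota ltnS.
have muK' : mu <= K by lia.
have bad := size_not_smooth_shift_leq B K1 muK' hc; rewrite -/X -/y -/M in bad.
set s' := [seq _ <- _ | _] in bad.
have ss' : size s + size s' = size (primes_in B X).
  by rewrite -[RHS](count_predC (smooth_shift y)) -!size_filter.
have hX := size_primes_in_pow2_geq (ltnW K1); rewrite -/X in hX.
have hB : size (primes_in 0 X) <= B + size (primes_in B X).
  have [BX|XB] := leqP B X.
    rewrite (@primes_in_cat 0 B X) // size_cat leq_add2r.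
    by rewrite (leq_trans (size_primes_in_leq _ _)) // subn0.
  rewrite (leq_trans (size_primes_in_leq _ _)) // subn0.
  by rewrite (leq_trans (ltnW XB)) // leq_addr.
have hy : K * size (primes_in 0 y) <= 12 * y.
  have := size_primes_in_pow2_leq (K - mu); rewrite -/y.
  have : K <= 2 * (K - mu) by lia.
  move: (K - mu) (size _) => a b h1 h2.
  have : K * b <= 2 * a * b by rewrite leq_mul2r h1 orbT.
  rewrite -mulnA; move: (K * b) (a * b) h2; clear; lia.
have hc2 : c * 2 ^ (2 * j) <= X * 2 ^ (2 * M + 4).
  rewrite /c big_nat_cond; elim/big_ind: _ => [|x1 x2 h1 h2|m].
  - by rewrite mul0n.
  - by rewrite /maxn; case: ifP.
  rewrite andbT ltnS => /andP[m0 mM].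
  have := size_prime_pairs_leq m0 mM M2 MJ j0 (erefl X).
  by rewrite -!natrX -!natrM ler_nat.
have hbad : 8 * (K * (M * c)) <= X.
  have hj : j * 2 ^ (mu + 2 * M + 13) <= 2 ^ j.
    apply: (@leq_trans (2 ^ e * 2 ^ e)); last by rewrite -expnD addnn -mul2n.
    by rewrite leq_mul ?double_leq_exp2 ?leq_exp2l // /e; lia.
  rewrite -(@leq_pmul2r (2 ^ (2 * j))) ?expn_gt0 //.
  rewrite (_ : 8 * _ * _ = 8 * (K * (M * (c * 2 ^ (2 * j))))); last by rewrite !mulnA.
  apply: (@leq_trans (8 * (K * (M * (X * 2 ^ (2 * M + 4)))))).
    exact: leq_mul (leqnn 8) (leq_mul (leqnn K) (leq_mul (leqnn M) hc2)).
  rewrite (_ : 8 * _ = X * 2 ^ j * (j * 2 ^ (mu + 2 * M + 13))).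
    rewrite (mul2n j) -addnn (expnD 2 j j) (mulnA X).
    exact: leq_mul (leqnn (X * 2 ^ j)) hj.
  rewrite (_ : mu + 2 * M + 13 = mu + (2 * M + 4) + 9); last by rewrite -addnA (addnA _ 4) addnA.
  rewrite !(expnD _ _ 9) (expnD _ mu) /K -/M [2 ^ 9]/=; move: (2 ^ j) (2 ^ (2 * M + 4)) (M) (X); clear.
  by move=> *; ring.
have hXy : X = M * y by rewrite -expnD subnKC.
have hKD : 16 * (K * (C * D + B)) <= X.
  pose K' := 32 * j * 2 ^ j.
  have KK : K = 2 * K' by rewrite /K /K' !mulnA.
  have jK : j <= K' by rewrite /K' -mulnA mulnCA leq_pmulr // muln_gt0 expn_gt0.
  have hE : 16 * (C * D + B) <= K' by apply: leq_trans jK; rewrite /j /e; lia.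
  have K'0 : 0 < K' by apply: leq_trans jK.
  rewrite mulnCA /X KK [X in 2 ^ X]mul2n -addnn expnD; apply: leq_mul.
    exact: double_leq_exp2.
  by rewrite (leq_trans hE) // ltnW // ltn_expl.
have K0 : 0 < K by lia.
have hCy : 8 * (C * (K * size (primes_in 0 y))) <= X.
  have h1 : C * (K * size (primes_in 0 y)) <= C * (12 * y) by rewrite leq_mul2l hy orbT.
  have h2 : 96 * C * y <= X by rewrite hXy leq_mul2r M96 orbT.
  apply: leq_trans h2; rewrite (_ : 96 * C * y = 8 * (C * (12 * y))); last by ring.
  by rewrite leq_mul2l.
have hXB : X <= 2 * (K * B) + 2 * (K * size s) + 2 * (K * (M * c)).
  apply: (leq_trans hX); rewrite -mul2n -mulnA -!mulnDr leq_mul2l /= leq_mul2l.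
  apply/orP; right; apply: (leq_trans hB); rewrite -ss' addnA leq_add2l.
  exact: bad.
rewrite -(leq_pmul2l K0).
have -> : K * (C * (size (primes_in 0 y) + D)) =
    C * (K * size (primes_in 0 y)) + K * (C * D) by ring.
move: hXB hCy hKD hbad; rewrite (mulnDr K).
move: (C * (K * size (primes_in 0 y))) (K * (C * D)) (K * B) (K * size s) (K * (M * c)) (X).
by clear; lia.
Qed.

(** * Zero-sum subfamilies *)

Lemma popular_value (S : finType) (A : {set S}) k (f : S -> 'I_k) : 0 < k ->
  exists a, #|A| <= k * #|[set c in A | f c == a]|.
Proof.
case: k f => // k f _.
pose F a := #|[set c in A | f c == a]|.
exists [arg max_(a > ord0) F a]; case: arg_maxnP => // a _ ha.
have -> : #|A| = \sum_b F b.
  rewrite -sum1_card (partition_big f xpredT) //=; apply: eq_bigr => b _.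
  by rewrite /F -sum1_card; apply: eq_bigl => c; rewrite inE.
have -> : k.+1 * #|[set c in A | f c == a]| = \sum_(b : 'I_k.+1) F a.
  by rewrite sum_nat_const card_ord.
apply: leq_sum => b _; exact: ha.
Qed.

(** Fixing the most frequent value of one coordinate leaves at most a fraction 1 - 1/k of [A]
    uncovered; after [N] coordinates fewer than one element is left. *)
Lemma covering_values (S : finType) k (f : nat -> S -> 'I_k) N (A : {set S}) : 0 < k ->
  #|A| * (k.-1) ^ N < k ^ N ->
  exists a : nat -> 'I_k, forall c, c \in A -> exists2 i, i < N & f i c = a i.
Proof.
move=> k0; elim: N A => [|N IH] A.
  rewrite !expn0 muln1 ltnS leqn0 cards_eq0 => /eqP ->.
  by exists (fun=> Ordinal k0) => c; rewrite inE.
move=> h; have [a ha] := popular_value A (f N) k0.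
pose A' := [set c in A | f N c != a].
have hA : #|A'| * k <= #|A| * k.-1.
  have : #|[set c in A | f N c == a]| + #|A'| = #|A|.
    rewrite -(cardsID [set c | f N c == a] A); congr (_ + _); apply: eq_card => c.
      by rewrite !inE.
    by rewrite !inE andbC.
  have aux x y n : n <= k * x -> x + y = n -> y * k <= n * k.-1.
    move: k0; clear; case: k => // k _; rewrite [k.+1.-1]/=; nia.
  exact: aux ha.
have [] := IH A'.
  rewrite -(ltn_pmul2r k0) -expnSr (leq_ltn_trans _ h) //.
  by rewrite mulnAC expnSr mulnA [leqRHS]mulnAC leq_mul2r hA orbT.
move=> b hb; exists (fun i => if i == N then a else b i) => c cA.
have [e|ne] := eqVneq (f N c) a; first by exists N; rewrite ?eqxx.
have [|i iN e] := hb c; first by rewrite inE cA.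
by exists i; [rewrite ltnW | rewrite ltn_eqF].
Qed.

(** By Bernoulli (1 - 1/k)^k <= 1/2, so the exponent k * (k R) gains a factor 2^(kR), which exceeds
    k^R. *)
Lemma zero_sum_size_bound k R N : 0 < k -> 0 < R -> k ^ 2 * R <= N ->
  k ^ R * k.-1 ^ N < k ^ N.
Proof.
move=> k0 R0 h.
have bern : 2 ^ (k * R) * k.-1 ^ (k * (k * R)) <= k ^ (k * (k * R)).
  rewrite [k.-1 ^ _]expnM [leqRHS]expnM -expnMn leq_exp2r ?muln_gt0 ?k0 //.
  case: (k) k0 => // n _ /=.
  have step i : n ^ i * (n + i) <= n.+1 ^ i * n.
    elim: i => [|i IH]; first by rewrite addn0.
    rewrite !expnS; apply: leq_trans (_ : n.+1 * (n ^ i * (n + i)) <= _).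
      by rewrite -!mulnA; move: (n ^ i) => u; nia.
    by rewrite -mulnA leq_mul2l IH orbT.
  have [->|n0] := posnP n; first by [].
  rewrite -(leq_pmul2r n0); apply: leq_trans (step n.+1).
  by rewrite -mulnA mulnCA leq_mul2l; apply/orP; right; lia.
have -> : N = k * (k * R) + (N - k ^ 2 * R) by rewrite mulnA mulnn subnKC.
rewrite !expnD mulnA.
have [P0|P0] := posnP (k.-1 ^ (k * (k * R))).
  by rewrite P0 muln0 mul0n muln_gt0 !expn_gt0 k0.
apply: (@leq_ltn_trans (k ^ R * k.-1 ^ (k * (k * R)) * k ^ (N - k ^ 2 * R))).
  by rewrite leq_mul2l; apply/orP; right; case: (N - _) => // m; rewrite leq_exp2r // leq_pred.
rewrite ltn_pmul2r ?expn_gt0 ?k0 //; apply: leq_trans bern.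
by rewrite ltn_pmul2r // expnM ltn_exp2r // ltn_expl.
Qed.

Local Open Scope ring_scope.

Lemma sum_roots_of_unity k (z : algC) s : k.-primitive_root z ->
  \sum_(c < k) z ^+ (c * s) = if (k %| s)%N then k%:R else 0.
Proof.
move=> pz; case: ifP => ks.
  rewrite (eq_bigr (fun=> 1)) ?sumr_const ?card_ord // => c _.
  by apply/eqP; rewrite -(prim_order_dvd pz) dvdn_mull.
have zs1 : z ^+ s != 1 by rewrite -(prim_order_dvd pz) ks.
apply: (mulfI (_ : z ^+ s - 1 != 0)); first by rewrite subr_eq0.
rewrite mulr0 (eq_bigr (fun c : 'I_k => (z ^+ s) ^+ c)); last first.
  by move=> c _; rewrite -exprM mulnC.
by rewrite -subrX1 -exprM mulnC exprM (prim_expr_order pz) expr1n subrr.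
Qed.

(* Greedily choose roots of unity alpha_i such that every character chi takes the value
   alpha_i at some v_i.  Then the sum over chi of prod_i (alpha_i - chi(v_i)) vanishes;
   expanding it, the subset I contributes 0 unless it has zero sum, so the nonzero
   contribution of the empty subset must be cancelled by another zero-sum subset. *)
Lemma zero_sum_subset (T : finType) (k N : nat) (v : nat -> T -> nat) :
  (0 < k)%N -> (0 < #|T|)%N -> (k ^ 2 * #|T| <= N)%N ->
  exists2 I : {set 'I_N}, I != set0 & forall t, (k %| \sum_(i in I) v i t)%N.
Proof.
move=> k0 T0 hN; have [z pz] := C_prim_root_exists k0.
pose e i (c : {ffun T -> 'I_k}) : nat := (\sum_t c t * v i t)%N.
have ltk x : (x %% k < k)%N by rewrite ltn_mod.
pose f i c : 'I_k := Ordinal (ltk (e i c)).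
have [|a ha] := @covering_values _ k f N setT k0.
  by rewrite cardsT card_ffun card_ord zero_sum_size_bound.
pose chi i c : algC := z ^+ e i c.
have chi0 (c : {ffun T -> 'I_k}) : \prod_(i < N) (- chi i c + z ^+ a i) = 0.
  have [i iN e1] := ha c (in_setT c).
  rewrite (bigD1 (Ordinal iN)) //= -e1 /chi -(prim_expr_mod pz) addNr mul0r //.
pose w (I : {set 'I_N}) : algC := \prod_(i < N) (if i \in I then -1 else z ^+ a i).
have expand : 0 = \sum_(I : {set 'I_N}) w I *
    \prod_(t : T) \sum_(c < k) z ^+ (c * \sum_(i in I) v i t).
  transitivity (\sum_(c : {ffun T -> 'I_k}) \prod_(i < N) (- chi i c + z ^+ a i)).
    by rewrite big1.
  under eq_bigr do rewrite bigA_distr.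
  rewrite exchange_big /=; apply: eq_bigr => I _.
  rewrite bigA_distr_bigA big_distrr /=; apply: eq_bigr => c _.
  have -> : \prod_t z ^+ (c t * \sum_(i in I) v i t) = \prod_(i in I) chi i c.
    rewrite -expr_sum.
    under eq_bigr do rewrite big_distrr /=.
    by rewrite exchange_big /= expr_sum.
  rewrite /w [X in _ = _ * X]big_mkcond -big_split /=; apply: eq_bigr => i _.
  by case: ifP => _; rewrite ?mulr1 ?mulN1r.
have [/existsP[I /andP[I0 /forallP hI]]|/existsPn none] :=
    boolP [exists I : {set 'I_N}, (I != set0) && [forall t, (k %| \sum_(i in I) v i t)%N]].
  by exists I.
(* Without a nonempty zero-sum subset only [set0] contributes, and its term is a root of unity times
   k^#|T|, hence nonzero. *)
move: expand; rewrite (bigD1 set0) //= [X in _ + X]big1 ?addr0.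
  move/esym/eqP; rewrite mulf_eq0 => /orP[].
    rewrite prodf_seq_eq0 => /hasP[i _]; rewrite inE /= expf_eq0 => /andP[_ /eqP z0].
    by have := prim_expr_order pz; rewrite z0 expr0n eqn0Ngt k0 => /eqP; rewrite eq_sym oner_eq0.
  rewrite prodf_seq_eq0 => /hasP[t _]; rewrite sum_roots_of_unity // big_set0 dvdn0.
  by rewrite /= pnatr_eq0 -leqn0 leqNgt k0.
move=> I I0; have := none I; rewrite I0 => /forallPn[t ht].
by rewrite (bigD1 t) //= sum_roots_of_unity // (negbTE ht) mul0r mulr0.
Qed.

Local Close Scope ring_scope.

(** * Multiplicativity of sigma and the choice of t *)

(** The divisors of m p are those of m together with their multiples by p, and the two families are
    disjoint as p does not divide m. *)
Lemma sigma_mul_prime m p : 0 < m -> prime p -> ~~ (p %| m) ->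
  sigma (m * p) = sigma m * p.+1.
Proof.
move=> m0 pp pm; have p0 := prime_gt0 pp.
have mp0 : 0 < m * p by rewrite muln_gt0 m0.
rewrite /sigma (perm_big (divisors m ++ [seq d * p | d <- divisors m])) /=.
  by rewrite big_cat big_map -big_distrl /= mulnS mulnC.
apply: uniq_perm; first exact: divisors_uniq.
  rewrite cat_uniq divisors_uniq /= map_inj_uniq ?divisors_uniq ?andbT; last first.
    by move=> x y /eqP; rewrite eqn_pmul2r // => /eqP.
  apply/hasPn => _ /mapP[d _ ->] /=; rewrite -dvdn_divisors //.
  by apply: contra pm => /(dvdn_trans _) ->; rewrite ?dvdn_mull.
move=> d; rewrite mem_cat -!dvdn_divisors //; apply/idP/orP => [|[dm|/mapP[c]]].
- have [pd|pd] := boolP (p %| d).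
    case/dvdnP: pd => c ->; rewrite dvdn_pmul2r // => cm; right.
    by apply/mapP; exists c; rewrite -?dvdn_divisors.
  by rewrite Gauss_dvdl; [left | rewrite coprime_sym prime_coprime].
- by rewrite dvdn_mulr.
- by rewrite -dvdn_divisors // => cm ->; rewrite dvdn_pmul2r.
Qed.

Lemma sigma_mul_primes m s : 0 < m -> uniq s -> all prime s ->
  {in s, forall p, ~~ (p %| m)} ->
  sigma (m * \prod_(p <- s) p) = sigma m * \prod_(p <- s) p.+1.
Proof.
elim: s m => [|p s IH] m m0 /=; first by rewrite !big_nil !muln1.
move=> /andP[ps us] /andP[pp sp] h; rewrite !big_cons !mulnA IH //.
- by rewrite sigma_mul_prime // h ?mem_head.
- by rewrite muln_gt0 m0 prime_gt0.
move=> q qs; have pq := allP sp _ qs.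
rewrite Euclid_dvdM // negb_or h ?inE ?qs ?orbT //= dvdn_prime2 //.
by apply: contraNneq ps => <-.
Qed.

Lemma is_kth_power_logn n e : 0 < n -> (forall p, prime p -> e %| logn p n) ->
  is_kth_power e n.
Proof.
move=> n0 h; exists (\prod_(p <- primes n) p ^ (logn p n %/ e)).
rewrite {1}[n]prod_prime_decomp // prime_decompE big_map /=.
rewrite (big_morph (expn^~ e) (id1 := 1) (op1 := muln)) ?exp1n //; last first.
  by move=> x y; rewrite expnMn.
rewrite big_seq [RHS]big_seq; apply: eq_bigr => p.
by rewrite mem_primes => /and3P[pp _ _]; rewrite -expnM divnK // h.
Qed.

Lemma logn_prod (I : finType) (P : pred I) (F : I -> nat) q :
  (forall i, P i -> 0 < F i) ->
  logn q (\prod_(i | P i) F i) = \sum_(i | P i) logn q (F i).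
Proof.
move=> F0; suff [] : 0 < \prod_(i | P i) F i /\
    logn q (\prod_(i | P i) F i) = \sum_(i | P i) logn q (F i) by [].
elim/big_rec2: _ => [|i x y Pi [y0 <-]]; first by rewrite logn1.
by rewrite muln_gt0 F0 // y0 lognM // F0.
Qed.

Lemma eqmod_prod (I : finType) (P : pred I) (F G : I -> nat) a :
  (forall i, P i -> F i = G i %[mod a]) ->
  \prod_(i | P i) F i = \prod_(i | P i) G i %[mod a].
Proof.
move=> h; elim/big_rec2: _ => // i x y Pi e.
by rewrite -modnMml -modnMmr h // e modnMml modnMmr.
Qed.

(** Grouping the factors by residue, each class occurs a multiple of [totient a] times, and Euler's
    theorem applies to it. *)
Lemma prod_eqmod1 (I : finType) (P : pred I) (F : I -> nat) a : 0 < a ->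
  (forall i, P i -> coprime (F i) a) ->
  (forall r, totient a %| \sum_(i | P i) (F i %% a == r)) ->
  \prod_(i | P i) F i = 1 %[mod a].
Proof.
move=> a0 co h.
have lta x : x %% a < a by rewrite ltn_mod.
rewrite (partition_big (fun i => Ordinal (lta (F i))) xpredT) //=.
rewrite (@eqmod_prod _ _ _ (fun=> 1)) ?big1_eq // => r _.
rewrite (@eqmod_prod _ _ _ (fun=> val r)); last first.
  by move=> i /andP[_ /eqP <-]; rewrite /= modn_mod.
rewrite prod_nat_const.
have -> : #|[pred i | P i && (Ordinal (lta (F i)) == r)]| = \sum_(i | P i) (F i %% a == r).
  by rewrite -sum1_card big_mkcondr.
have [i /andP[Pi /eqP ir]|none] := pickP (fun i => P i && (F i %% a == r)).
  have /dvdnP[c ->] := h r.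
  have cr : coprime r a by rewrite -ir coprime_modl co.
  by rewrite mulnC expnM -modnXm Euler_exp_totient // modnXm exp1n.
(* A class that does not occur may fail to be coprime to [a], but its exponent is 0. *)
rewrite big1 ?expn0 // => i Pi; have := none i; rewrite Pi /= => ->.
by [].
Qed.

Lemma prime_set_shift_power (a B e : nat) : 0 < a -> 0 < e -> totient a %| e ->
  exists s : seq nat, [/\ s != [::], uniq s, {in s, forall p, prime p && (B < p)},
    \prod_(p <- s) p = 1 %[mod a] & exists z, \prod_(p <- s) p.+1 = z ^ e].
Proof.
move=> a0 e0 tot.
(* There is one coordinate for each prime up to [y] and one for each of the [a] residues; [e ^ 2] is
   the factor in [zero_sum_subset]. Primes above [B + a] are coprime to [a]. *)
have [y [s [us ps ss hs]]] := smooth_shifted_primes (B + a) (e ^ 2) a.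
pose Q := primes_in 0 y; pose x i := nth 0 s i.
pose v i (t : 'I_(size Q) + 'I_a) : nat :=
  match t with inl q => logn (nth 0 Q q) (x i).+1 | inr r => (x i %% a == r) end.
have T0 : 0 < #|{: 'I_(size Q) + 'I_a}| by rewrite card_sum !card_ord addn_gt0 a0 orbT.
have [|I I0 hI] := @zero_sum_subset _ e (size s) v e0 T0.
  by rewrite card_sum !card_ord.
have xs (i : 'I_(size s)) : x i \in s by rewrite mem_nth.
exists [seq x i | i : 'I_(size s) <- enum I]; split.
- by rewrite -size_eq0 size_map -cardE cards_eq0.
- rewrite map_inj_in_uniq ?enum_uniq // => i j _ _ /eqP.
  by rewrite nth_uniq ?ltn_ord // => /eqP /val_inj.
- move=> _ /mapP[i _ ->]; have /andP[-> /=] := ps _ (xs i).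
  by apply: leq_ltn_trans; rewrite leq_addr.
- rewrite big_map big_enum /=; apply: prod_eqmod1 => // [i _|r].
    have /andP[pp pB] := ps _ (xs i).
    rewrite prime_coprime //; apply/negP => /(dvdn_leq a0); lia.
  have [ra|ra] := ltnP r a; last first.
    rewrite big1 ?dvdn0 // => i _; case: eqP => // er.
    by move: ra; rewrite leqNgt -er ltn_mod a0.
  exact: dvdn_trans tot (hI (inr (Ordinal ra))).
rewrite big_map big_enum /=; apply: is_kth_power_logn.
  by apply: prodn_gt0.
move=> q pq; rewrite logn_prod //.
have [qy|yq] := leqP q y.
  have qQ : q \in Q by rewrite mem_primes_in pq prime_gt0.
  have iq : index q Q < size Q by rewrite index_mem.
  by have := hI (inl (Ordinal iq)); rewrite /= nth_index.
rewrite big1 ?dvdn0 // => i _; apply/eqP; rewrite -leqn0 leqNgt logn_gt0.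
by apply/negP => /(allP (ss _ (xs i))); rewrite leqNgt yq.
Qed.

Theorem theorem2 (a b k : nat) (ha : 1 <= a) (hk : 2 <= k) :
  (forall n : nat, 1 <= n -> ~ is_kth_power k (sigma (a * n + b))) \/
  (forall N : nat, exists n : nat, N < n /\ is_kth_power k (sigma (a * n + b))).
Proof.
have [|h] := classic (forall n, 1 <= n -> ~ is_kth_power k (sigma (a * n + b))); first by left.
right=> N; apply: NNPP => hN; apply: h => n0 n0_gt0 [x0 hx0]; apply: hN.
set m := a * n0 + b in hx0.
have m0 : 0 < m by rewrite addn_gt0 muln_gt0 ha n0_gt0.
have tot0 : 0 < totient a by rewrite totient_gt0.
have e0 : 0 < k * totient a by rewrite muln_gt0 tot0 andbT ltnW.
(* Primes above [m + a * N] do not divide [m], and they make [t] large enough to push the new index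
   beyond [N]. The exponent [k * totient a] is a multiple of both [k] and [totient a]. *)
have [s [s0 us ps s1 [z hz]]] :=
  prime_set_shift_power (m + a * N) ha e0 (dvdn_mull k (dvdnn _)).
set t := \prod_(p <- s) p in s1.
have aps : all prime s by apply/allP => p /ps /andP[].
have tB : m + a * N < t.
  rewrite /t; case: (s) s0 ps aps => // p s' _ ps' /= /andP[_ aps].
  rewrite big_cons; have /andP[_ h] := ps' p (mem_head p s').
  apply: (leq_trans h); rewrite leq_pmulr //.
  by rewrite big_seq; apply: prodn_cond_gt0 => q /(allP aps)/prime_gt0.
have [u tu] : exists u, t = 1 + a * u.
  have /dvdnP[u hu] : a %| t - 1 by rewrite -eqn_mod_dvd ?s1 //; lia.
  by exists u; rewrite mulnC -hu subnKC //; lia.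
(* This index is chosen so that a (n0 + m u) + b = m (1 + a u) = m t. *)
exists (n0 + m * u); split.
  have Nu : N <= u by rewrite -ltnS -(ltn_pmul2l ha) mulnS; lia.
  by rewrite -addn1 addnC leq_add // (leq_trans Nu) // leq_pmull.
exists (x0 * z ^ totient a).
have -> : a * (n0 + m * u) + b = m * t by rewrite tu /m; ring.
rewrite sigma_mul_primes // ?hx0 ?hz ?expnMn -?expnM 1?(mulnC k) //.
move=> p /ps /andP[pp hp]; apply/negP => /(dvdn_leq m0); lia.
Qed.
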